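(* Let $A\in\mathcal{B}(\mathcal{H})$ be a selfadjoint operator on a real or complex Hilbert space $\mathcal{H}$ and let $\mathcal{F}$ and $\mathcal{G}$ be nontrivial subspaces of $\mathcal{H}$. Then the Hausdorff distance between the sets of Ritz values of $A$ with respect to the trial subspaces $\mathcal{F}$ and $\mathcal{G}$ satisfies $$\mathrm{dist}\big(\Sigma((P_{\mathcal{F}}A)|_{\mathcal{F}}),\ \Sigma((P_{\mathcal{G}}A)|_{\mathcal{G}})\big)\le\big(\max\{\Sigma(A)\}-\min\{\Sigma(A)\}\big)\,\mathrm{gap}(\mathcal{F},\mathcal{G}).$$
   Context: A subspace means a closed linear manifold; nontrivial means different from $\{0\}$. $\mathcal{B}(\mathcal{H})$ is the space of bounded linear operators on $\mathcal{H}$; $P_{\mathcal{F}}$ is the orthogonal projector onto $\mathcal{F}$; $\Sigma$ denotes the spectrum; $(P_{\mathcal{F}}A)|_{\mathcal{F}}$ is regarded as an operator $\mathcal{F}\to\mathcal{F}$, and its spectrum is called the set of Ritz values corresponding to $A$ and $\mathcal{F}$. For bounded real sets $S_1,S_2$, $\mathrm{dist}(S_1,S_2)=\max\{\sup_{u\in S_1}\mathrm{dist}(u,S_2),\sup_{v\in S_2}\mathrm{dist}(v,S_1)\}$ is the Hausdorff distance, where $\mathrm{dist}(u,S)=\inf_{v\in S}|u-v|$. The gap is $\mathrm{gap}(\mathcal{F},\mathcal{G})=\|P_{\mathcal{F}}-P_{\mathcal{G}}\|$ (operator norm). *)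

(* Defs.v *)
From HB Require Import structures.
From mathcomp Require Import all_boot all_order all_algebra complex.
From mathcomp Require Import boolp classical_sets reals topology normedtype.

Set Implicit Arguments.
Unset Strict Implicit.
Unset Printing Implicit Defensive.
Import Order.TTheory GRing.Theory Num.Theory numFieldNormedType.Exports.
Local Open Scope classical_set_scope.
Local Open Scope ring_scope.

Variant base_field := RealBase | ComplexBase.

Definition scalars (R : realType) (k : base_field) : numFieldType :=
  match k with RealBase => R | ComplexBase => R[i] end.

Definition scalar_conj (R : realType) (k : base_field) :
    scalars R k -> scalars R k :=
  match k with RealBase => idfun | ComplexBase => @conjc R end.

Definition scalar_re (R : realType) (k : base_field) : scalars R k -> R :=
  match k with RealBase => idfun | ComplexBase => @complex.Re R end.

Arguments scalar_conj {R k}.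
Arguments scalar_re {R k}.

Section HilbertSpace.
Variables (R : realType) (k : base_field).
Local Notation K := (scalars R k).

(* Norms in a normedModType over K take values in K, including for K = R[i];
   they are real and nonnegative there, and [nrm] reads them in R. *)
Definition nrm (V : normedModType K) (x : V) : R := scalar_re `|x|.

Variable H : completeNormedModType K.
Implicit Types (F G : set H) (T : H -> H).

(* With this compatibility, [H] is a Hilbert space with inner product [ip]
   (linear in the first argument, conjugate-linear in the second). *)
Definition inner_product_norm (ip : {dot H for @scalar_conj R k}) :=
  forall x, `|x| ^+ 2 = ip x x.

Definition closed_subspace F := GRing.submod_closed (mem F) /\ closed F.

Definition bounded_on F T := exists M : R, forall x, F x -> nrm (T x) <= M * nrm x.

(* [T] restricts to an element of B(F); values outside F are irrelevant. *)
Definition bounded_operator_on F T :=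
  [/\ forall x, F x -> F (T x),
      forall a x y, F x -> F y -> T (a *: x + y) = a *: T x + T y
    & bounded_on F T].

(* Spectrum of [T] regarded as an operator F -> F: the scalars [l] such that
   l - T has no inverse in B(F). *)
Definition spectrum_on F T : set K :=
  [set l | ~ exists S : H -> H, bounded_operator_on F S /\
     forall x, F x -> S (l *: x - T x) = x /\ l *: S x - T (S x) = x].

Definition spectrum T : set K := spectrum_on [set: H] T.

Variable ip : {dot H for @scalar_conj R k}.

Definition selfadjoint T := forall x y, ip (T x) y = ip x (T y).

(* Orthogonal projector; the described point exists and is unique whenever [F]
   is a subspace of the Hilbert space [H]. *)
Definition proj F (x : H) : H :=
  xget 0 [set p | F p /\ forall y, F y -> ip (x - p) y = 0].

Definition ritz_values T F : set K := spectrum_on F (fun x => proj F (T x)).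

Definition opnorm T : R := sup [set nrm (T x) | x in [set x | nrm x <= 1]].

Definition gap F G : R := opnorm (fun x => proj F x - proj G x).

End HilbertSpace.

(* Distances are computed among scalars; for sets of real scalars, such as the
   spectra of selfadjoint operators, |u - v| is the distance in R. *)
Section Hausdorff.
Variables (R : realType) (k : base_field).
Local Notation K := (scalars R k).
Implicit Types S : set K.

Definition dist_to (u : K) S : R := inf [set scalar_re `|u - v| | v in S].

Definition hausdorff_dist S1 S2 : R :=
  Num.max (sup [set dist_to u S2 | u in S1]) (sup [set dist_to v S1 | v in S2]).

(* On R[i], z <= w means that w - z is real and nonnegative, so an extremum
   of a set lies on the same horizontal line as all its elements. *)
Definition is_min S (m : K) := S m /\ lbound S m.
Definition is_max S (m : K) := S m /\ ubound S m.

End Hausdorff.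

(* Main.v *)
Require Import Defs.
From mathcomp Require Import all_boot all_order all_algebra complex.
From mathcomp Require Import boolp classical_sets reals topology normedtype.
From mathcomp Require Import sequences interval_inference.
From mathcomp Require Import ring lra.

(** Let [P] and [Q] be the projectors onto [F] and [G], let [c] be the gap, and
    let [m] and [M] be the infimum and the supremum of the form [<A x, x>] on
    unit vectors; [form_inf] and [form_sup] identify them with the minimum and
    the maximum of the spectrum of [A]. All Ritz values lie in [[m, M]]
    ([ritz_range]), which settles the case [1 <= c]: any Ritz value of [G] is
    within [M - m] of any Ritz value of [F].

    Let [c < 1]. Then [P Q] restricted to [F] is at least [1 - c ^+ 2], hence
    has a square root [S] with [S >= sqrt (1 - c ^+ 2)], and [W = Q S^-1], the
    isometric factor in the polar decomposition of [Q P], maps [F] isometrically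
    onto [G]. It moves vectors by an angle whose sine is at most [c]:
    [<f, W f> >= sqrt (1 - c ^+ 2) |f| ^+ 2] ([isometry_of_gap]). Since
    [A' = A - (M + m) / 2] has norm at most [(M - m) / 2], the number
    [<A f, f> - <A W f, W f> = <A' (f + W f), f - W f>] is at most
    [(M - m) / 2 * |f + W f| * |f - W f| <= (M - m) c |f| ^+ 2] ([form_diff]),
    and the same bound holds for the polarized form ([form_bound]). So if [f] is
    an approximate eigenvector of [P A] on [F] for [r], then [W f] satisfies
    [|(r - Q A) W f| <= ((M - m) c + e) |W f|] in [G]. A symmetric operator that
    has a vector of relative residual [d] at [r] has spectrum within distance
    [d] of [r] ([near_real_spectrum]), and the bound follows by exchanging [F]
    and [G].

    Two choices keep this elementary. All estimates use the real inner product
    [re <x, y>], which treats both base fields at once; complex scalars occur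
    only where [spectrum_onP] shows that the spectrum of a symmetric operator on
    a closed subspace consists of the real [r] for which [r - T] is not bounded
    below. And inverses, square roots and [near_real_spectrum] come from
    fixed-point iterations and forms with infimum 0, with no functional
    calculus. *)

Set Implicit Arguments.
Unset Strict Implicit.
Unset Printing Implicit Defensive.
Import Order.TTheory GRing.Theory Num.Theory numFieldNormedType.Exports.
Local Open Scope classical_set_scope.
Local Open Scope ring_scope.

(** * Real scalars in the base field *)

Definition scalar_emb {R : realType} {k : base_field} : R -> scalars R k :=
  match k with RealBase => idfun | ComplexBase => real_complex R end.

Section Scalars.
Context {R : realType} {k : base_field}.
Local Notation K := (scalars R k).
Implicit Types (r s : R) (a b : K).

Lemma re_emb r : scalar_re (scalar_emb r : K) = r.
Proof. by case: k. Qed.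

Lemma embN r : scalar_emb (- r) = - scalar_emb r :> K.
Proof. by case: k => //=; exact: rmorphN. Qed.

Lemma embM r s : scalar_emb (r * s) = scalar_emb r * scalar_emb s :> K.
Proof. by case: k => //=; exact: rmorphM. Qed.

Lemma embB r s : scalar_emb (r - s) = scalar_emb r - scalar_emb s :> K.
Proof. by case: k => //=; exact: rmorphB. Qed.

Lemma embD r s : scalar_emb (r + s) = scalar_emb r + scalar_emb s :> K.
Proof. by case: k => //=; exact: rmorphD. Qed.

Lemma emb0 : scalar_emb 0 = 0 :> K.
Proof. by case: k. Qed.

Lemma emb1 : scalar_emb 1 = 1 :> K.
Proof. by case: k. Qed.

Lemma embn n : scalar_emb n%:R = n%:R :> K.
Proof. by case: k => //=; exact: rmorph_nat. Qed.

Lemma emb_le r s : ((scalar_emb r : K) <= scalar_emb s) = (r <= s).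
Proof. by case: k => //=; exact: lecR. Qed.

Lemma emb_lt r s : ((scalar_emb r : K) < scalar_emb s) = (r < s).
Proof. by case: k => //=; exact: ltcR. Qed.

Lemma reD a b : scalar_re (a + b) = scalar_re a + scalar_re b.
Proof. by case: k a b => //= -[? ?] [? ?]. Qed.

Lemma reN a : scalar_re (- a) = - scalar_re a.
Proof. by case: k a => //= -[? ?]. Qed.

Lemma re_embM r a : scalar_re (scalar_emb r * a) = r * scalar_re a.
Proof. by case: k a => //= -[? ?] /=; rewrite mul0r subr0. Qed.

Lemma re_conj a : scalar_re (scalar_conj a) = scalar_re a.
Proof. by case: k a => //= -[? ?]. Qed.

Lemma conjM a b : scalar_conj (a * b) = scalar_conj a * scalar_conj b.
Proof. by case: k a b => //= a b; exact: rmorphM. Qed.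

Lemma re_conj_mul_eq0 a : scalar_re (scalar_conj a * a) = 0 -> a = 0.
Proof.
case: k a => /= [a /eqP|[x y] /= xy0]; first by rewrite mulf_eq0 orbb => /eqP.
have [/eqP x0 /eqP y0] : x ^+ 2 = 0 /\ y ^+ 2 = 0 by split; nra.
by move: x0 y0; rewrite !sqrf_eq0 => /eqP -> /eqP ->.
Qed.

Lemma conjK a : scalar_conj (scalar_conj a) = a.
Proof. by case: k a => //= a; exact: conjcK. Qed.

Lemma conj_fix_emb a : scalar_conj a = a -> a = scalar_emb (scalar_re a).
Proof.
case: k a => //= -[x y] [] /eqP; rewrite eq_sym -addr_eq0 -mulr2n mulrn_eq0 /=.
by move=> /eqP ->.
Qed.

(** The scalar [b = i im a] is orthogonal to the reals and not to [a]; it serves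
    to bound [a - T] below for symmetric [T] and nonreal [a]. *)
Lemma nonreal_imaginary a : scalar_conj a <> a ->
  exists2 b, scalar_conj b = - b & 0 < scalar_re (scalar_conj b * a).
Proof.
case: k a => //= -[x y] xy; exists (0 +i* y)%C; first by rewrite /= /GRing.opp /= oppr0.
have y0 : y != 0 by apply/eqP => y0; apply: xy; rewrite /= y0 oppr0.
by rewrite /= mul0r sub0r mulNr opprK -expr2 exprn_even_gt0.
Qed.

Lemma norm_emb a : `|a| = scalar_emb (scalar_re `|a|).
Proof. by apply: conj_fix_emb; case: k a => //= a; rewrite oppr0. Qed.

Lemma ge0_emb a : 0 <= a -> a = scalar_emb (scalar_re a).
Proof. by move=> /ger0_norm <-; exact: norm_emb. Qed.

Lemma re_norm_ge0 a : 0 <= scalar_re `|a|.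
Proof.
by have := normr_ge0 a; rewrite {1}norm_emb -emb0 emb_le.
Qed.

Lemma re_norm_emb r : scalar_re `|scalar_emb r : K| = `|r|.
Proof. by case: k => //=; rewrite expr0n /= addr0 sqrtr_sqr. Qed.
End Scalars.

(** * The underlying real inner product *)

Section RealInnerProduct.
Context {R : realType} {k : base_field}.
Local Notation K := (scalars R k).
Context {H : completeNormedModType K}.
Variable ip : {dot H for @scalar_conj R k}.
Hypothesis ip_norm : inner_product_norm ip.
Implicit Types (r s : R) (x y z : H).

Definition rip x y : R := scalar_re (ip x y).

Definition rscale r x : H := (scalar_emb r : K) *: x.

Lemma ipC x y : ip x y = scalar_conj (ip y x).
Proof. by rewrite hermitian_subproof expr0 mul1r. Qed.

Lemma ipZl a x y : ip (a *: x) y = a * ip x y.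
Proof. exact: linearZl_LR. Qed.

Lemma ipZr a x y : ip x (a *: y) = scalar_conj a * ip x y.
Proof. by rewrite ipC ipZl conjM -ipC. Qed.

Lemma ripC x y : rip x y = rip y x.
Proof. by rewrite /rip ipC re_conj. Qed.

Lemma ripDl x y z : rip (x + y) z = rip x z + rip y z.
Proof. by rewrite /rip -reD; congr scalar_re; exact: linearDl. Qed.

Lemma ripDr x y z : rip x (y + z) = rip x y + rip x z.
Proof. by rewrite !(ripC x) ripDl. Qed.

Lemma ripNl x y : rip (- x) y = - rip x y.
Proof. by rewrite /rip -reN; congr scalar_re; exact: linearNl. Qed.

Lemma ripNr x y : rip x (- y) = - rip x y.
Proof. by rewrite !(ripC x) ripNl. Qed.

Lemma ripZl r x y : rip (rscale r x) y = r * rip x y.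
Proof. by rewrite /rip ipZl re_embM. Qed.

Lemma ripZr r x y : rip x (rscale r y) = r * rip x y.
Proof. by rewrite ripC ripZl ripC. Qed.

Definition ripE := (ripDl, ripDr, ripNl, ripNr, ripZl, ripZr).

Lemma rip0r x : rip x 0 = 0.
Proof. by rewrite -(subrr x) !ripE subrr. Qed.

Lemma rip0l x : rip 0 x = 0.
Proof. by rewrite ripC rip0r. Qed.

Lemma norm_nrm x : `|x| = scalar_emb (nrm x) :> K.
Proof. by apply: ge0_emb. Qed.

Lemma nrm_ge0 x : 0 <= nrm x.
Proof. by rewrite -(emb_le (k := k)) -norm_nrm emb0. Qed.

Lemma nrm_sqr x : nrm x ^+ 2 = rip x x.
Proof. by rewrite /rip -ip_norm !expr2 {1}norm_nrm re_embM. Qed.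

Lemma nrmZ_scalar a x : nrm (a *: x) = scalar_re `|a| * nrm x.
Proof. by rewrite /nrm normrZ {1}norm_emb re_embM. Qed.

Lemma nrmZ r x : nrm (rscale r x) = `|r| * nrm x.
Proof. by rewrite nrmZ_scalar re_norm_emb. Qed.

Lemma nrm0 : nrm (0 : H) = 0.
Proof. by apply/eqP; rewrite -sqrf_eq0 nrm_sqr rip0r. Qed.

Lemma nrm_eq0 x : nrm x = 0 -> x = 0.
Proof. by move=> x0; apply/eqP; rewrite -normr_eq0 norm_nrm x0 emb0. Qed.

Lemma nrmN x : nrm (- x) = nrm x.
Proof. by rewrite /nrm normrN. Qed.

Lemma nrm_gt0 x : x <> 0 -> 0 < nrm x.
Proof. by move=> x0; rewrite lt_def nrm_ge0 andbT; apply/eqP => /nrm_eq0. Qed.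

Lemma nrmD x y : nrm (x + y) <= nrm x + nrm y.
Proof.
by rewrite -(emb_le (k := k)) embD -!norm_nrm ler_normD.
Qed.

Lemma nrmBC x y : nrm (x - y) = nrm (y - x).
Proof. by rewrite -nrmN opprB. Qed.

Lemma nrm_chain y x z : nrm (x - z) <= nrm (x - y) + nrm (y - z).
Proof. by rewrite -[x - z](subrKA y) nrmD. Qed.

Lemma nrm_sqrD x y : nrm (x + y) ^+ 2 = nrm x ^+ 2 + 2 * rip x y + nrm y ^+ 2.
Proof. by rewrite !nrm_sqr !ripE (ripC y x); ring. Qed.

Lemma nrm_sqrB x y : nrm (x - y) ^+ 2 = nrm x ^+ 2 - 2 * rip x y + nrm y ^+ 2.
Proof. by rewrite nrm_sqrD nrmN ripNr; ring. Qed.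

(** Cauchy-Schwarz for the real part, read off the triangle inequality. *)
Lemma rip_le x y : rip x y <= nrm x * nrm y.
Proof.
have : nrm (x + y) ^+ 2 <= (nrm x + nrm y) ^+ 2.
  by rewrite ler_pXn2r ?nnegrE ?addr_ge0 ?nrm_ge0 // nrmD.
by rewrite nrm_sqrD; nra.
Qed.

Lemma rip_ge x y : - (nrm x * nrm y) <= rip x y.
Proof. by rewrite lerNl -ripNl -(nrmN x) rip_le. Qed.

Lemma nrm_eq0_rip x : rip x x <= 0 -> x = 0.
Proof.
rewrite -nrm_sqr => x0; apply: nrm_eq0; apply/eqP.
by rewrite -sqrf_eq0 eq_le x0 sqr_ge0.
Qed.

(** * Completeness and closed subspaces *)

(** A limit in the real norm: with the scalar field possibly complex, this
    spares the positive elements of [K] in epsilon arguments. *)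
Definition converges (u : nat -> H) (l : H) := forall e : R, 0 < e ->
  exists N, forall n, (N <= n)%N -> nrm (u n - l) <= e.

Lemma converges_cvg u l : converges u l -> u @ \oo --> l.
Proof.
move=> ul; apply/cvgrPdist_le => e e0.
have ee := ge0_emb (ltW e0).
have re0 : 0 < scalar_re e.
  by rewrite -(emb_lt (k := k)) -ee emb0.
have [N uN] := ul _ re0; exists N => // n /= Nn.
by rewrite ee norm_nrm emb_le nrmBC uN.
Qed.

Lemma closed_converges (F : set H) u l : closed F ->
  (forall n, F (u n)) -> converges u l -> F l.
Proof.
by move=> Fc Fu ul; apply: (closed_cvg _ Fc _ _ (converges_cvg ul)); exact: nearW.
Qed.

Lemma cauchy_converges u :
  (forall e : R, 0 < e -> exists N, forall m n, (N <= m)%N -> (N <= n)%N ->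
    nrm (u m - u n) <= e) -> exists l, converges u l.
Proof.
move=> uC.
have /cauchy_cvgP/cvg_ex[l ul] : cauchy (u @ \oo).
  apply/cauchy_exP => e e0; have ee := ge0_emb (ltW e0).
  have re0 : 0 < scalar_re e.
    by rewrite -(emb_lt (k := k)) -ee emb0.
  have [|N uN] := uC (scalar_re e / 2); first by rewrite divr_gt0.
  exists (u N), N => // n /= Nn.
  rewrite -ball_normE /= ee norm_nrm emb_lt.
  by apply: le_lt_trans (uN _ _ _ _) _ => //; rewrite gtr_pMr // invf_lt1 ?ltr1n.
exists l => e e0; move/cvgrPdist_le : ul => /(_ (scalar_emb e)).
have -> : 0 < (scalar_emb e : K).
  by rewrite -emb0 emb_lt.
by move=> /(_ isT)[N _ uN]; exists N => n /uN /=; rewrite norm_nrm emb_le nrmBC.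
Qed.

(** Contractions produce increments of this size, whether of vectors, as in
    [contraction_fixpoint], or of operators, as in [square_root]. *)
Lemma geometric_converges u (C q : R) : 0 <= C -> 0 <= q -> q < 1 ->
  (forall n, nrm (u n.+1 - u n) <= C * q ^+ n) ->
  exists l, converges u l.
Proof.
move=> C0 q0 q1 uq; have q1' : 0 < 1 - q by rewrite subr_gt0.
set D := C / (1 - q); have D0 : 0 <= D by rewrite divr_ge0 // ltW.
have tail n p : nrm (u n - u (n + p)%N) <= D * (q ^+ n - q ^+ (n + p)).
  elim: p => [|p IH]; first by rewrite addn0 !subrr nrm0 mulr0.
  have := nrm_chain (u (n + p)%N) (u n) (u (n + p.+1)%N).
  rewrite addnS (nrmBC (u (n + p)%N)); have := uq (n + p)%N => h1 h2.
  apply: le_trans h2 _; apply: le_trans (lerD IH h1) _.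
  rewrite exprS (_ : C = D * (1 - q)); last by rewrite divfK ?gt_eqF.
  by lra.
have tail' n p : nrm (u n - u (n + p)%N) <= D * q ^+ n.
  by apply: le_trans (tail n p) _; rewrite ler_wpM2l // gerBl exprn_ge0.
have small (e : R) : 0 < e -> exists N, forall n, (N <= n)%N -> D * q ^+ n <= e.
  move=> e0; have : (fun n => D * q ^+ n) @ \oo --> D * 0.
    by apply: cvgMr; apply: cvg_expr; rewrite ger0_norm.
  rewrite mulr0 => /cvgrPdist_le/(_ e e0)[N _ hN]; exists N => n /hN /=.
  by rewrite sub0r normrN ger0_norm // mulr_ge0 // exprn_ge0.
apply: cauchy_converges => e e0.
have [|N hN] := small (e / 2); first by rewrite divr_gt0.
have {}hN := hN _ (leqnn N).
exists N => m n Nm Nn; apply: le_trans (nrm_chain (u N) _ _) _.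
rewrite -(subnKC Nm) -(subnKC Nn) (nrmBC _ (u N)).
by have := tail' N (m - N)%N; have := tail' N (n - N)%N; lra.
Qed.

Section Subspace.
Variable F : set H.
Hypothesis Fs : closed_subspace F.

Lemma sub0 : F 0.
Proof. by case: Fs => -[] /set_mem. Qed.

Lemma sub_linear a x y : F x -> F y -> F (a *: x + y).
Proof.
by case: Fs => -[] _ Fl _ Fx Fy; apply/set_mem/Fl; apply/mem_set.
Qed.

Lemma subD x y : F x -> F y -> F (x + y).
Proof. by rewrite -{2}[x]scale1r; exact: sub_linear. Qed.

Lemma subZ a x : F x -> F (a *: x).
Proof. by move=> Fx; rewrite -[_ *: _]addr0; apply: sub_linear => //; exact: sub0. Qed.

Lemma subN x : F x -> F (- x).
Proof. by rewrite -scaleN1r; exact: subZ. Qed.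

Lemma subB x y : F x -> F y -> F (x - y).
Proof. by move=> Fx /subN; exact: subD. Qed.

Lemma contraction_fixpoint (f : H -> H) (q : R) : 0 <= q -> q < 1 ->
  (forall x, F x -> F (f x)) ->
  (forall x y, F x -> F y -> nrm (f x - f y) <= q * nrm (x - y)) ->
  exists2 x, F x & f x = x.
Proof.
move=> q0 q1 Ff fq; pose u n := iter n f 0.
have Fu n : F (u n) by elim: n => [|n IH] /=; [exact: sub0|exact: Ff].
have [|l ul] := geometric_converges (u := u) (nrm_ge0 (f 0)) q0 q1.
  elim=> [|n IH]; first by rewrite /= subr0 expr0 mulr1.
  have := fq _ _ (Fu n.+1) (Fu n); move/le_trans; apply; rewrite exprS mulrCA; exact: ler_wpM2l.
have Fl := closed_converges (proj2 Fs) Fu ul.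
exists l => //; apply/eqP; rewrite -subr_eq0; apply/eqP/nrm_eq0/eqP.
rewrite eq_le nrm_ge0 andbT; apply/ler_addgt0Pr => e e0; rewrite add0r.
have [|N uN] := ul (e / 2); first by rewrite divr_gt0.
apply: le_trans (nrm_chain (u N.+1) _ _) _.
have := uN N.+1 (leqnSn N); have := uN N (leqnn N).
have := fq _ _ Fl (Fu N); rewrite (nrmBC l) -/(u N.+1).
by have := nrm_ge0 (u N - l); nra.
Qed.

(** * Orthogonal projection *)

(** Minimizing sequences are Cauchy by the parallelogram identity. *)
Lemma nearest_point x : exists2 p, F p & forall y, F y -> nrm (x - p) <= nrm (x - y).
Proof.
pose D := [set nrm (x - y) | y in F]; set d := inf D.
have D_inf : has_inf D.
  by split; [exists (nrm (x - 0)), 0 => //; exact: sub0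
            |exists 0 => _ [y _ <-]; exact: nrm_ge0].
have d_le y : F y -> d <= nrm (x - y) by move=> Fy; apply: ge_inf; [exact: D_inf.2|exists y].
have d0 : 0 <= d by apply: lb_le_inf; [exact: D_inf.1|move=> _ [y _ <-]; exact: nrm_ge0].
have /choice[u uP] (n : nat) : exists y, F y /\ nrm (x - y) <= d + n.+1%:R^-1.
  have [|_ [y Fy <-] yd] := inf_adherent (eps := n.+1%:R^-1) _ D_inf.
    by rewrite invr_gt0 ltr0n.
  by exists y; split => //; exact: ltW.
have small (e : R) : 0 < e -> exists N, forall n, (N <= n)%N -> (n.+1%:R^-1 : R) <= e.
  move=> e0; have [N _ hN] := near_infty_natSinv_lt (PosNum e0).
  by exists N => n /hN /= /ltW.
have uC (e : R) : 0 < e -> exists N, forall m n, (N <= m)%N -> (N <= n)%N ->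
    nrm (u m - u n) <= e.
  (* Two points within [d + c] of [x] differ by at most
     [4 (d + c) ^+ 2 - 4 d ^+ 2 <= c (8 d + 4)] in squared norm. *)
  move=> e0; pose c := Num.min 1 (e ^+ 2 / (8 * d + 4)).
  have c0 : 0 < c by rewrite lt_min ltr01 divr_gt0 ?exprn_gt0 //; lra.
  have [N hN] := small _ c0; exists N => m n Nm Nn.
  have c1 : c <= 1 by rewrite ge_min lexx.
  have ce : c * (8 * d + 4) <= e ^+ 2.
    by rewrite -ler_pdivlMr; [rewrite ge_min lexx orbT|lra].
  have [Fm um] := uP m; have [Fn un] := uP n.
  have {}um := le_trans um (lerD (lexx d) (hN _ Nm)).
  have {}un := le_trans un (lerD (lexx d) (hN _ Nn)).
  set a := x - u m in um *; set b := x - u n in un *.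
  have mid : d <= nrm (x - rscale 2^-1 (u m + u n)) by apply/d_le/subZ/subD.
  have midE : x - rscale 2^-1 (u m + u n) = rscale 2^-1 (a + b).
    have h2 : x = rscale 2^-1 (x + x).
      by rewrite /rscale -mulr2n -(scaler_nat 2 x) scalerA -embn -embM mulVf // emb1 scale1r.
    by rewrite {1}h2 /rscale -scalerBr /a /b opprD addrACA.
  rewrite midE nrmZ ger0_norm ?invr_ge0 // in mid.
  have abE : u m - u n = b - a by rewrite /a /b opprB [_ + (u m - _)]addrC subrKA.
  rewrite abE -(ler_pXn2r (n := 2)) ?nnegrE ?nrm_ge0 ?(ltW e0) // nrm_sqrB.
  have := nrm_sqrD a b; have := nrm_ge0 a; have := nrm_ge0 b; have := nrm_ge0 (a + b).
  move=> ab0 b0 a0 abD.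
  have ab2 : (2 * d) ^+ 2 <= nrm (a + b) ^+ 2.
    by rewrite ler_pXn2r ?nnegrE //; lra.
  have a2 : nrm a ^+ 2 <= (d + c) ^+ 2 by rewrite ler_pXn2r ?nnegrE //; lra.
  have b2 : nrm b ^+ 2 <= (d + c) ^+ 2 by rewrite ler_pXn2r ?nnegrE //; lra.
  rewrite ripC; have : c ^+ 2 <= c by nra.
  by nra.
have [p up] := cauchy_converges uC.
have Fp : F p by apply: (closed_converges (proj2 Fs) _ up) => n; case: (uP n).
exists p => // y /d_le; apply: le_trans.
apply/ler_addgt0Pr => e e0; have [|N hN] := up (e / 2); first by rewrite divr_gt0.
have [|M hM] := small (e / 2); first by rewrite divr_gt0.
apply: le_trans (nrm_chain (u (N + M)%N) _ _) _.
have := hN _ (leq_addr M N); have := hM _ (leq_addl N M); have [_] := uP (N + M)%N.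
move=> h1 h2 h3; apply: le_trans (lerD h1 h3) _; rewrite -addrA lerD2l [leRHS]splitr lerD2r; exact: h2.
Qed.

(** At a nearest point [p], moving along [z] by [s * rip (x - p) z] with a small
    [s] would decrease the distance unless [rip (x - p) z = 0]. Passing from the
    real part to [ip] uses that [F] is stable under all scalars. *)
Lemma proj_exists x : exists p, F p /\ forall y, F y -> ip (x - p) y = 0.
Proof.
have [p Fp pmin] := nearest_point x; exists p; split=> // y Fy.
have rip0 z : F z -> rip (x - p) z = 0.
  move=> Fz; set c := rip _ _; set s := (nrm z ^+ 2 + 1)^-1.
  have s0 : 0 < s by rewrite invr_gt0 ltr_wpDl // sqr_ge0.
  have sz : s * nrm z ^+ 2 <= 1.
    by rewrite mulrC ler_pdivrMr ?mul1r ?lerDl // ltr_wpDl // sqr_ge0.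
  have := pmin (p + rscale (c * s) z) (subD Fp (subZ _ Fz)).
  rewrite opprD addrA -(ler_pXn2r (n := 2)) ?nnegrE ?nrm_ge0 //.
  rewrite (nrm_sqrB (x - p)) ripZr -/c nrmZ exprMn real_normK ?num_real // => h.
  have cs : c ^+ 2 * s * (s * nrm z ^+ 2) <= c ^+ 2 * s * 1.
    by rewrite ler_wpM2l // mulr_ge0 ?sqr_ge0 // ltW.
  have : c ^+ 2 * s <= 0 by nra.
  rewrite pmulr_lle0 // => c0; apply/eqP.
  by rewrite -sqrf_eq0 eq_le c0 sqr_ge0.
by apply/re_conj_mul_eq0; rewrite -ipZr; exact/rip0/subZ.
Qed.

Lemma proj_in x : F (proj ip F x).
Proof. by have [] := xgetPex 0 (proj_exists x). Qed.

Lemma proj_rip x y : F y -> rip (proj ip F x) y = rip x y.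
Proof.
move=> Fy; have [_ /(_ _ Fy) h] := xgetPex 0 (proj_exists x).
have : rip (x - proj ip F x) y = 0 by rewrite /rip h; case: (k).
by rewrite !ripE; lra.
Qed.

Lemma proj_ripr x y : F x -> rip x (proj ip F y) = rip x y.
Proof. by move=> Fx; rewrite ripC proj_rip // ripC. Qed.

Lemma eq_rip x y : F x -> F y -> (forall z, F z -> rip x z = rip y z) -> x = y.
Proof.
move=> Fx Fy xy; apply/eqP; rewrite -subr_eq0; apply/eqP/nrm_eq0_rip.
by rewrite ripDl ripNl xy ?subrr //; exact: subB.
Qed.

Lemma proj_id x : F x -> proj ip F x = x.
Proof. by move=> Fx; apply: eq_rip => // [|z]; [exact: proj_in|exact: proj_rip]. Qed.

(** Orthogonality to [F] characterizes the projection among the points of [F],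
    so linearity can be tested against vectors of [F]. *)
Lemma proj_linear a x y : proj ip F (a *: x + y) = a *: proj ip F x + proj ip F y.
Proof.
apply: eq_rip => [||z Fz]; [exact: proj_in|by apply: sub_linear; exact: proj_in|].
have ripP u v : rip (a *: u + v) z = rip u (scalar_conj a *: z) + rip v z.
  by rewrite ripDl /rip ipZl ipZr conjK.
by rewrite proj_rip // !ripP !proj_rip //; exact: subZ.
Qed.

Lemma projB x y : proj ip F (x - y) = proj ip F x - proj ip F y.
Proof. by rewrite addrC -scaleN1r proj_linear scaleN1r addrC. Qed.

Lemma nrm_proj_sqr x : nrm (proj ip F x) ^+ 2 = rip (proj ip F x) x.
Proof. by rewrite nrm_sqr proj_ripr //; exact: proj_in. Qed.

Lemma nrm_proj x : nrm (proj ip F x) <= nrm x.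
Proof.
have := nrm_proj_sqr x; have := rip_le (proj ip F x) x.
by have := nrm_ge0 (proj ip F x); have := nrm_ge0 x; nra.
Qed.
(** * Operators on a closed subspace *)

Section Operator.
Variable T : H -> H.
Hypothesis opT : bounded_operator_on F T.

Lemma op_in x : F x -> F (T x).
Proof. by case: opT => h _ _; exact: h. Qed.

Lemma op_linear a x y : F x -> F y -> T (a *: x + y) = a *: T x + T y.
Proof. by case: opT => _ h _; exact: h. Qed.

Lemma opD x y : F x -> F y -> T (x + y) = T x + T y.
Proof. by move=> Fx Fy; rewrite -{1}[x]scale1r op_linear // scale1r. Qed.

Lemma op0 : T 0 = 0.
Proof. by apply: (addrI (T 0)); rewrite -opD ?addr0 //; exact: sub0. Qed.

Lemma opZ a x : F x -> T (a *: x) = a *: T x.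
Proof. by move=> Fx; rewrite -[a *: x]addr0 op_linear ?op0 ?addr0 //; exact: sub0. Qed.

Lemma opB x y : F x -> F y -> T (x - y) = T x - T y.
Proof.
by move=> Fx Fy; rewrite -scaleN1r opD ?opZ ?scaleN1r //; exact: subN.
Qed.

Lemma op_bound : exists2 M, 0 < M & forall x, F x -> nrm (T x) <= M * nrm x.
Proof.
case: opT => _ _ [M hM]; exists (`|M| + 1); first by rewrite ltr_wpDl.
move=> x Fx; apply: le_trans (hM x Fx) _; rewrite ler_wpM2r ?nrm_ge0 //.
by rewrite (le_trans (ler_norm M)) // lerDl.
Qed.

(** Lax-Milgram: for small [t] the map [x - t (T x - y)] is a contraction. *)
Lemma coercive_onto (a : R) : 0 < a ->
  (forall x, F x -> a * nrm x ^+ 2 <= rip (T x) x) ->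
  forall y, F y -> exists2 x, F x & T x = y.
Proof.
move=> a0 Ta y Fy; have [M0 M00 TM0] := op_bound; pose M := M0 + a.
have M_gt0 : 0 < M by rewrite addr_gt0.
have TM x : F x -> nrm (T x) <= M * nrm x.
  move=> Fx; apply: le_trans (TM0 _ Fx) _.
  by rewrite ler_wpM2r ?nrm_ge0 // lerDl ltW.
(* [t] minimizes [1 - 2 t a + t ^+ 2 M ^+ 2], and [p] is that minimum. *)
pose t := a / M ^+ 2; pose p := 1 - a ^+ 2 / M ^+ 2.
have t0 : 0 < t by rewrite divr_gt0 // exprn_gt0.
have tM : t * M ^+ 2 = a by rewrite divfK // expf_neq0 ?gt_eqF.
have pE : p = 1 - t * a by rewrite /p /t; ring.
have p0 : 0 <= p.
  rewrite subr_ge0 ler_pdivrMr ?exprn_gt0 // mul1r.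
  by rewrite ler_pXn2r ?nnegrE ?ltW // ltrDr.
have p1 : p < 1 by rewrite pE gtrBl mulr_gt0.
have [|x Fx|x z Fx Fz|x Fx fx] := @contraction_fixpoint
    (fun x => x - rscale t (T x - y)) (Num.sqrt p) (sqrtr_ge0 _).
- by rewrite -(sqrtr1 R) ltr_sqrt.
- by apply/subB/subZ/subB => //; exact: op_in.
- set w := x - z; have Fw : F w by exact: subB.
  have -> : x - rscale t (T x - y) - (z - rscale t (T z - y)) = w - rscale t (T w).
    have swap (u v : H) : x - u - (z - v) = w - (u - v).
      by rewrite /w opprD opprK opprB addrACA [- u + v]addrC.
    by rewrite swap -scalerBr opB // opprB addrA addrNK.
  rewrite -(ler_pXn2r (n := 2)) ?nnegrE ?mulr_ge0 ?sqrtr_ge0 ?nrm_ge0 //.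
  rewrite nrm_sqrB ripZr nrmZ !exprMn sqr_sqrtr // real_normK ?num_real //.
  have := Ta _ Fw; have := TM _ Fw; rewrite ripC => h1 h2.
  have h3 : nrm (T w) ^+ 2 <= M ^+ 2 * nrm w ^+ 2.
    by rewrite -exprMn ler_pXn2r ?nnegrE ?mulr_ge0 ?nrm_ge0 // ltW.
  have h4 : t ^+ 2 * nrm (T w) ^+ 2 <= t * a * nrm w ^+ 2.
    rewrite -tM; have := ler_wpM2l (sqr_ge0 t) h3; move/le_trans; apply.
    by rewrite le_eqVlt; apply/orP; left; apply/eqP; ring.
  have h5 : t * (a * nrm w ^+ 2) <= t * rip w (T w) by rewrite ler_pM2l.
  by rewrite pE; lra.
exists x => //; apply/eqP; rewrite -subr_eq0; apply/eqP.
have : rscale t (T x - y) = 0.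
  by apply: (addrI (- rscale t (T x - y))); rewrite addNr addr0; apply: (addrI x); rewrite fx addr0.
move=> /(congr1 (fun u : H => nrm u)); rewrite nrmZ nrm0 => /eqP; rewrite mulf_eq0 normr_eq0 gt_eqF //=.
by move/eqP/nrm_eq0.
Qed.
End Operator.

Lemma op_comp T1 T2 : bounded_operator_on F T1 -> bounded_operator_on F T2 ->
  bounded_operator_on F (fun x => T1 (T2 x)).
Proof.
move=> op1 op2; split=> [x Fx|a x y Fx Fy|]; first exact/(op_in op1)/op_in.
  by rewrite (op_linear op2) // (op_linear op1) //; exact: op_in.
have [M1 M10 h1] := op_bound op1; have [M2 M20 h2] := op_bound op2.
exists (M1 * M2) => x Fx; apply: le_trans (h1 _ (op_in op2 Fx)) _.
by rewrite -mulrA ler_pM2l // h2.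
Qed.

Lemma op_lin T1 T2 (a b : K) : bounded_operator_on F T1 -> bounded_operator_on F T2 ->
  bounded_operator_on F (fun x => a *: T1 x + b *: T2 x).
Proof.
move=> op1 op2; split=> [x Fx|c x y Fx Fy|].
- by apply/subD/subZ/op_in => //; apply/subZ/op_in.
- rewrite (op_linear op2) // (op_linear op1) // !scalerDr !scalerA addrACA.
  by rewrite ![_ * c]mulrC.
have [M1 M10 h1] := op_bound op1; have [M2 M20 h2] := op_bound op2.
exists (scalar_re `|a| * M1 + scalar_re `|b| * M2) => x Fx.
apply: le_trans (nrmD _ _) _; rewrite !nrmZ_scalar mulrDl -!mulrA.
by rewrite lerD // ler_wpM2l ?re_norm_ge0 // (h1, h2).
Qed.

Lemma op_id : bounded_operator_on F id.
Proof. by split=> //; exists 1 => x _; rewrite mul1r. Qed.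

Lemma op_ext T1 T2 : bounded_operator_on F T1 -> T1 =1 T2 -> bounded_operator_on F T2.
Proof. by move=> op1 /funext <-. Qed.

Lemma op_scalarB T a : bounded_operator_on F T ->
  bounded_operator_on F (fun x => a *: x - T x).
Proof.
move=> opT; apply: op_ext (op_lin a (-1) op_id opT) _ => x.
by rewrite scaleN1r.
Qed.

Definition bounded_below (T : H -> H) :=
  exists2 c : R, 0 < c & forall x, F x -> c * nrm x <= nrm (T x).

Definition sym_on (T : H -> H) := forall x y, F x -> F y -> rip (T x) y = rip x (T y).

(** With [L'] adjoint to [L], the form of [L L'] is [nrm (L' x) ^+ 2], so [L L']
    is coercive when [L'] is bounded below, and then [L] is onto. The inverse is
    bounded because [L] is bounded below. *)
Lemma bounded_below_inverse L L' : bounded_operator_on F L ->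
  bounded_operator_on F L' ->
  (forall x y, F x -> F y -> rip (L x) y = rip x (L' y)) ->
  bounded_below L -> bounded_below L' ->
  exists S, bounded_operator_on F S /\ forall x, F x -> S (L x) = x /\ L (S x) = x.
Proof.
move=> opL opL' adj [c c0 Lc] [c' c'0 Lc'].
have L_inj x y : F x -> F y -> L x = L y -> x = y.
  move=> Fx Fy Lxy; apply/eqP; rewrite -subr_eq0; apply/eqP/nrm_eq0/eqP.
  rewrite eq_le nrm_ge0 andbT -(ler_pM2l c0) mulr0.
  by apply: le_trans (Lc _ (subB Fx Fy)) _; rewrite (opB opL) // Lxy subrr nrm0.
have L_onto y : F y -> exists x, F x /\ L x = y.
  move=> Fy; have [|x Fx|x Fx LLx] :=
    coercive_onto (op_comp opL opL') (a := c' ^+ 2) _ _ Fy; first exact: exprn_gt0.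
    rewrite adj //; last exact: op_in.
    rewrite -nrm_sqr -exprMn.
    by rewrite ler_pXn2r ?nnegrE ?mulr_ge0 ?nrm_ge0 ?(ltW c'0) // Lc'.
  by exists (L' x); split => //; exact: op_in.
pose S y := xget 0 [set x | F x /\ L x = y].
have SP y : F y -> F (S y) /\ L (S y) = y by move=> /L_onto; exact: xgetPex.
exists S; split; last first.
  move=> x Fx; split; last exact: (SP _ Fx).2.
  by have [FS LS] := SP _ (op_in opL Fx); exact: L_inj.
split=> [x /SP[] //|a x y Fx Fy|].
  have [FSx LSx] := SP _ Fx; have [FSy LSy] := SP _ Fy.
  have [FS LS] := SP _ (sub_linear a Fx Fy).
  by apply: L_inj => //; [exact: sub_linear|rewrite LS (op_linear opL) // LSx LSy].
exists c^-1 => x Fx; have [FSx LSx] := SP _ Fx.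
by rewrite mulrC ler_pdivlMr // mulrC -{2}LSx Lc.
Qed.
(** * Spectra of symmetric operators *)

(** The real points of the approximate point spectrum, which is the whole
    spectrum of a symmetric operator by [spectrum_onP]. *)
Definition real_spectrum (T : H -> H) (r : R) := ~ bounded_below (fun x => rscale r x - T x).

Lemma sym_shift T r : sym_on T -> sym_on (fun x => rscale r x - T x).
Proof. by move=> symT x y Fx Fy; rewrite !ripE symT. Qed.

(** For imaginary [b] and symmetric [T] the number [rip (T x) (b *: x)] vanishes,
    so [rip (a *: x - T x) (b *: x)] is a positive multiple of [nrm x ^+ 2]. *)
Lemma bounded_below_nonreal T a : bounded_operator_on F T -> sym_on T ->
  scalar_conj a <> a -> bounded_below (fun x => a *: x - T x).
Proof.
move=> opT symT /nonreal_imaginary[b bN]; set c := scalar_re _ => c0.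
pose m := scalar_re `|b| + 1; have m0 : 0 < m by rewrite ltr_wpDl ?re_norm_ge0.
exists (c / m); first exact: divr_gt0.
move=> x Fx; rewrite mulrAC ler_pdivrMr //.
have Tb : rip (T x) (b *: x) = 0.
  have : rip (T x) (b *: x) = - rip (T x) (b *: x); last lra.
  rewrite {1}symT ?(opZ opT) //; last exact: subZ.
  by rewrite ripC /rip ipZl ipZr bN mulNr reN opprK.
have cE : rip (a *: x - T x) (b *: x) = c * nrm x ^+ 2.
  rewrite ripDl ripNl Tb subr0 /rip ipZl ipZr mulrA [a * _]mulrC -ip_norm.
  rewrite norm_nrm expr2 -embM -expr2. by rewrite [X in scalar_re X]mulrC re_embM [LHS]mulrC.
have [x0|/eqP x0] := eqVneq x 0.
  by rewrite x0 nrm0 mulr0 mulr_ge0 ?nrm_ge0 ?ltW.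
have := rip_le (a *: x - T x) (b *: x); rewrite cE nrmZ_scalar => h.
rewrite -(ler_pM2r (nrm_gt0 x0)); have := nrm_ge0 (a *: x - T x).
have := nrm_ge0 x; rewrite /m; have := re_norm_ge0 b; nra.
Qed.

(** If both [l - T] and its adjoint are bounded below, [l] is outside the
    spectrum by [bounded_below_inverse]. This covers every nonreal [l], and for
    real [l] the two operators coincide. *)
Lemma spectrum_onP T l : bounded_operator_on F T -> sym_on T ->
  spectrum_on F T l <-> exists2 r, l = scalar_emb r & real_spectrum T r.
Proof.
move=> opT symT; split=> [spec_l|[r -> spec_r] [S [[_ _ [M hM]] invS]]].
  have inv : bounded_below (fun x => l *: x - T x) ->
      bounded_below (fun x => scalar_conj l *: x - T x) -> False.
    move=> bl bl'; apply: spec_l; apply: bounded_below_inverse bl bl'.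
    - exact: op_scalarB.
    - exact: op_scalarB.
    - move=> x y Fx Fy; rewrite !ripDl !ripDr !ripNl !ripNr symT //.
      by rewrite /rip ipZl ipZr conjK.
  have [lE|lN] := pselect (scalar_conj l = l).
    exists (scalar_re l); first exact: conj_fix_emb.
    by move=> bl; apply: inv; rewrite ?lE (conj_fix_emb lE).
  exfalso; apply: inv; apply: bounded_below_nonreal => //.
  by rewrite conjK => /esym.
apply: spec_r; exists (`|M| + 1)^-1; first by rewrite invr_gt0 ltr_wpDl.
move=> x Fx; rewrite mulrC ler_pdivrMr ?ltr_wpDl // mulrC.
have /= [SL _] := invS x Fx.
rewrite -{1}SL; apply: le_trans (hM _ _) _.
  exact: (op_in (op_scalarB _ opT)).
rewrite ler_wpM2r ?nrm_ge0 //.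
by rewrite (le_trans (ler_norm M)) // lerDl.
Qed.

Lemma approximate_eigenvector T r e : real_spectrum T r -> 0 < e ->
  exists x, [/\ F x, 0 < nrm x & nrm (rscale r x - T x) < e * nrm x].
Proof.
move=> spec_r e0; apply: contrapT => noex; apply: spec_r; exists e => // x Fx.
rewrite leNgt; apply/negP => lt_x; apply: noex; exists x; split=> //.
by have := nrm_ge0 (rscale r x - T x); have := nrm_ge0 x; nra.
Qed.

Lemma bounded_below_comp L1 L2 : (forall x, F x -> F (L2 x)) ->
  bounded_below L1 -> bounded_below L2 -> bounded_below (fun x => L1 (L2 x)).
Proof.
move=> FL [c1 c10 h1] [c2 c20 h2]; exists (c1 * c2); first exact: mulr_gt0.
move=> x Fx; apply: le_trans (h1 _ (FL _ Fx)).
by rewrite -mulrA ler_pM2l // h2.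
Qed.

(** For a nonnegative operator bounded by [M],
    [nrm (N x) ^+ 2 <= M * rip (N x) x]: expand the form at [x - t N x] with
    [t = 1 / M]. Hence a form with infimum 0 on unit vectors forbids a lower
    bound of the operator, which is how spectral points are found below. *)
Lemma bounded_below_form N : bounded_operator_on F N -> sym_on N ->
  (forall x, F x -> 0 <= rip (N x) x) -> bounded_below N ->
  exists2 a : R, 0 < a & forall x, F x -> a * nrm x ^+ 2 <= rip (N x) x.
Proof.
move=> opN symN N0 [c c0 Nc]; have [M M0 hM] := op_bound opN.
exists (c ^+ 2 / M); first by rewrite divr_gt0 ?exprn_gt0.
move=> x Fx; have FN := op_in opN Fx.
have cx : c ^+ 2 * nrm x ^+ 2 <= nrm (N x) ^+ 2.
  by rewrite -exprMn ler_pXn2r ?nnegrE ?mulr_ge0 ?nrm_ge0 ?(ltW c0) // Nc.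
rewrite mulrAC ler_pdivrMr //; apply: le_trans cx _.
have := N0 _ (subB Fx (subZ (scalar_emb M^-1) FN)).
rewrite -/(rscale _ _) (opB opN) ?(opZ opN) //; last exact: subZ.
rewrite -/(rscale _ _) !ripE (symN (N x)) // -!nrm_sqr.
have := rip_le (N (N x)) (N x); have := hM _ FN; rewrite (symN (N x)) // => h1 h2 h3.
have h4 : rip (N x) (N (N x)) <= M * nrm (N x) ^+ 2.
  apply: le_trans h2 _; rewrite expr2 mulrA ler_wpM2r ?nrm_ge0 //.
have h5 : M^-1 * (M^-1 * rip (N x) (N (N x))) <= M^-1 * nrm (N x) ^+ 2.
  by rewrite ler_pM2l ?invr_gt0 // mulrC ler_pdivrMr // mulrC.
have : M^-1 * nrm (N x) ^+ 2 <= rip (N x) x by lra.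
by rewrite mulrC ler_pdivrMr.
Qed.

Lemma op_real_shift T r : bounded_operator_on F T ->
  bounded_operator_on F (fun x => rscale r x - T x).
Proof. exact: op_scalarB. Qed.

(** With [L = r - T] and [c] the best lower bound of [nrm (L x) / nrm x], the
    operator [L ^+ 2 - c ^+ 2 = (L + c) (L - c)] is nonnegative with a form of
    infimum 0, so that one of its two factors is not bounded below. *)
Lemma near_real_spectrum T r d x0 : bounded_operator_on F T -> sym_on T ->
  F x0 -> 0 < nrm x0 -> nrm (rscale r x0 - T x0) <= d * nrm x0 ->
  exists2 s, real_spectrum T s & `|r - s| <= d.
Proof.
move=> opT symT Fx0 x00 dx0; pose L x := rscale r x - T x.
have opL : bounded_operator_on F L by exact: op_real_shift.
have symL : sym_on L by exact: sym_shift.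
pose Q := [set nrm (L x) / nrm x | x in [set x | F x /\ 0 < nrm x]].
have Q_inf : has_inf Q.
  split; first by exists (nrm (L x0) / nrm x0), x0.
  by exists 0 => _ [x [Fx x_gt0] <-]; rewrite divr_ge0 ?nrm_ge0.
pose c := inf Q.
have c0 : 0 <= c.
  apply: lb_le_inf; first exact: Q_inf.1.
  by move=> _ [x [Fx x_gt0] <-]; rewrite divr_ge0 ?nrm_ge0.
have cL x : F x -> c * nrm x <= nrm (L x).
  move=> Fx; have [x_gt0|] := ltP 0 (nrm x).
    by rewrite -ler_pdivlMr //; apply: ge_inf; [exact: Q_inf.2|exists x].
  by move=> x_le0; rewrite (le_trans _ (nrm_ge0 _)) // mulr_ge0_le0.
have cd : c <= d by rewrite -(ler_pM2r x00); exact: le_trans (cL _ Fx0) dx0.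
suff [s spec_s rs] : exists2 s, real_spectrum T s & `|r - s| = c.
  by exists s; rewrite ?rs.
apply: contrapT => noex.
have bdd s : `|r - s| = c -> bounded_below (fun x => rscale s x - T x).
  by move=> rs; apply: contrapT => spec_s; apply: noex; exists s.
have b1 := bdd (r + c); have b2 := bdd (r - c).
have {b1} := b1 _; rewrite opprD addNKr normrN ger0_norm // => /(_ erefl) b1.
have {b2} := b2 _; rewrite opprB addrC subrK ger0_norm // => /(_ erefl) b2.
have op2 : bounded_operator_on F (fun x => rscale (r - c) x - T x).
  exact: op_real_shift.
have op1 : bounded_operator_on F (fun x => rscale (r + c) x - T x).
  exact: op_real_shift.
pose N x := rscale (r + c) (rscale (r - c) x - T x) - T (rscale (r - c) x - T x).
have NE x y : F x -> F y -> rip (N x) y = rip (L x) (L y) - c ^+ 2 * rip x y.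
  move=> Fx Fy; rewrite (sym_shift _ symT) //; last exact: (op_in op2).
  by rewrite /L !ripE (symT x y) //; ring.
have [||||a a0 aN] := @bounded_below_form N.
- exact: (op_comp op1 op2).
- by move=> x y Fx Fy; rewrite [RHS]ripC !NE // (ripC (L x)) (ripC x).
- move=> x Fx; rewrite NE // -!nrm_sqr subr_ge0 -exprMn.
  by rewrite ler_pXn2r ?nnegrE ?mulr_ge0 ?nrm_ge0 // cL.
- exact: (bounded_below_comp (op_in op2) b1 b2).
pose c' := Num.sqrt (c ^+ 2 + a).
have cc' : c < c'.
  by rewrite -{1}(ger0_norm c0) -sqrtr_sqr ltr_sqrt ?ltrDl // ltr_wpDl ?sqr_ge0.
have : c' <= c.
  apply: lb_le_inf; first exact: Q_inf.1.
  move=> _ [x [Fx x_gt0] <-]; rewrite ler_pdivlMr //.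
  rewrite -(ler_pXn2r (n := 2)) ?nnegrE ?mulr_ge0 ?nrm_ge0 ?sqrtr_ge0 //.
  rewrite exprMn sqr_sqrtr ?addr_ge0 ?sqr_ge0 ?(ltW a0) //.
  by have := aN _ Fx; rewrite NE // -!nrm_sqr; lra.
by rewrite leNgt cc'.
Qed.
(** At the supremum [M] of the form, [M - T] is nonnegative with a form of
    infimum 0. *)
Lemma form_sup T x0 : bounded_operator_on F T -> sym_on T -> F x0 -> 0 < nrm x0 ->
  exists2 M, real_spectrum T M & forall x, F x -> rip (T x) x <= M * nrm x ^+ 2.
Proof.
move=> opT symT Fx0 x00; have [B B0 TB] := op_bound opT.
pose Q := [set rip (T x) x / nrm x ^+ 2 | x in [set x | F x /\ 0 < nrm x]].
have QB : ubound Q B.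
  move=> _ [x [Fx x_gt0] <-]; rewrite ler_pdivrMr ?exprn_gt0 //.
  apply: le_trans (rip_le _ _) _; rewrite expr2 mulrA ler_wpM2r ?nrm_ge0 //.
  exact: TB.
have Q0 : Q !=set0 by exists (rip (T x0) x0 / nrm x0 ^+ 2), x0.
have Q_sup : has_sup Q by split=> //; exists B.
pose M := sup Q.
have MT x : F x -> rip (T x) x <= M * nrm x ^+ 2.
  move=> Fx; have [x_gt0|x_le0] := ltP 0 (nrm x).
    rewrite -ler_pdivrMr ?exprn_gt0 //; apply: sup_upper_bound => //.
    by exists x.
  have -> : x = 0 by apply/nrm_eq0/eqP; rewrite eq_le x_le0 nrm_ge0.
  by rewrite rip0r nrm0 expr0n mulr0.
exists M => // bM; have [|a a0 aN] := bounded_below_form (op_real_shift M opT) (sym_shift M symT) _ bM.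
  by move=> x Fx; rewrite !ripE -nrm_sqr subr_ge0 MT.
have : M <= M - a; last by rewrite leNgt gtrBl a0.
apply: ge_sup => // _ [x [Fx x_gt0] <-]; rewrite ler_pdivrMr ?exprn_gt0 //.
by have := aN _ Fx; rewrite !ripE -nrm_sqr; lra.
Qed.

Lemma real_spectrum_opp T r : real_spectrum (fun x => - T x) r -> real_spectrum T (- r).
Proof.
move=> spec_r [c c0 hc]; apply: spec_r; exists c => // x Fx.
have -> : rscale r x - - T x = - (rscale (- r) x - T x).
  by rewrite opprB /rscale embN scaleNr !opprK addrC.
have {}hc := hc x Fx.
by rewrite nrmN hc.
Qed.

Lemma op_opp T : bounded_operator_on F T -> bounded_operator_on F (fun x => - T x).
Proof.
move=> opT; apply: op_ext (op_scalarB 0 opT) _ => x.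
by rewrite scale0r sub0r.
Qed.

Lemma form_inf T x0 : bounded_operator_on F T -> sym_on T -> F x0 -> 0 < nrm x0 ->
  exists2 m, real_spectrum T m & forall x, F x -> m * nrm x ^+ 2 <= rip (T x) x.
Proof.
move=> opT symT Fx0 x00.
have [|M specM hM] := form_sup (op_opp opT) _ Fx0 x00.
  by move=> x y Fx Fy; rewrite !ripE symT.
exists (- M); first exact: real_spectrum_opp.
by move=> x Fx; have := hM x Fx; rewrite !ripE; lra.
Qed.

Lemma real_spectrum_le T r M : real_spectrum T r ->
  (forall x, F x -> rip (T x) x <= M * nrm x ^+ 2) -> r <= M.
Proof.
move=> spec_r hM; rewrite leNgt; apply/negP => Mr.
have [|x [Fx x_gt0 xlt]] := approximate_eigenvector (e := r - M) spec_r.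
  by rewrite subr_gt0.
have := rip_le (rscale r x - T x) x; have := hM _ Fx; rewrite !ripE -nrm_sqr.
have : nrm (rscale r x - T x) * nrm x < (r - M) * nrm x * nrm x by rewrite ltr_pM2r.
by rewrite expr2; nra.
Qed.

Lemma real_spectrum_ge T r m : real_spectrum T r ->
  (forall x, F x -> m * nrm x ^+ 2 <= rip (T x) x) -> m <= r.
Proof.
move=> spec_r hm; rewrite -lerN2; apply: (@real_spectrum_le (fun x => - T x)).
  by apply: real_spectrum_opp; move: spec_r; rewrite -{1}(_ : (fun x => - - T x) = T) //;
    apply/funext => x; rewrite opprK.
by move=> x Fx; have := hm x Fx; rewrite !ripE; lra.
Qed.

(** * Symmetric forms and their quadratic forms *)

(** Polarization: a symmetric bilinear form is bounded by its quadratic form. *)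
Lemma form_bound (b : H -> H -> R) (d : R) :
  (forall x y z, F x -> F y -> F z -> b (x + y) z = b x z + b y z) ->
  (forall r x y, F x -> F y -> b (rscale r x) y = r * b x y) ->
  (forall x y, F x -> F y -> b x y = b y x) ->
  (forall x, F x -> `|b x x| <= d * nrm x ^+ 2) ->
  forall x y, F x -> F y -> b x y <= d * nrm x * nrm y.
Proof.
move=> bD bZ bC bd x y Fx Fy.
have bZr r u v : F u -> F v -> b u (rscale r v) = r * b u v.
  by move=> Fu Fv; rewrite bC ?bZ 1?bC //; exact: subZ.
have bDr u v w : F u -> F v -> F w -> b u (v + w) = b u v + b u w.
  by move=> Fu Fv Fw; rewrite bC ?bD ?(bC v) ?(bC w) //; exact: subD.
have b0 u v : F u -> F v -> nrm u = 0 -> b u v = 0.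
  move=> Fu Fv /nrm_eq0 ->; have F0 := sub0.
  have := bD 0 0 v F0 F0 Fv; rewrite addr0; lra.
have [x_gt0|x_le0] := ltP 0 (nrm x); last first.
  have x0 : nrm x = 0 by apply/eqP; rewrite eq_le x_le0 nrm_ge0.
  by rewrite b0 // x0 mulr0 mul0r.
have [y_gt0|y_le0] := ltP 0 (nrm y); last first.
  have y0 : nrm y = 0 by apply/eqP; rewrite eq_le y_le0 nrm_ge0.
  by rewrite bC // b0 // y0 mulr0.
(* Rescaled to a common norm, the two vectors make polarization sharp. *)
pose u := rscale (nrm y) x; pose v := rscale (nrm x) y.
have Fu : F u by exact: subZ. have Fv : F v by exact: subZ.
have Fm : F (rscale (-1) v) by exact: subZ.
have nu : nrm u = nrm y * nrm x by rewrite nrmZ ger0_norm ?nrm_ge0.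
have nv : nrm v = nrm x * nrm y by rewrite nrmZ ger0_norm ?nrm_ge0.
have uv : b u v = nrm x * nrm y * b x y by rewrite bZ ?bZr //; ring.
clearbody u v; have := bd _ (subD Fu Fv); have := bd _ (subD Fu Fm).
rewrite !nrm_sqrD ripZr nrmZ normrN normr1 mul1r.
rewrite !bD ?bDr //; try exact: subD.
rewrite !bZ ?bZr // (bC v u) // nu nv uv.
rewrite !ler_norml => /andP[h1 _] /andP[_ h2].
have xy_gt0 : 0 < nrm x * nrm y by exact: mulr_gt0.
rewrite -(ler_pM2l xy_gt0); lra.
Qed.

Lemma sym_bound T d : bounded_operator_on F T -> sym_on T ->
  (forall x, F x -> `|rip (T x) x| <= d * nrm x ^+ 2) ->
  forall x y, F x -> F y -> rip (T x) y <= d * nrm x * nrm y.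
Proof.
move=> opT symT hd; apply: form_bound (fun x y => rip (T x) y) d _ _ _ hd => [x y z Fx Fy _|r x y Fx _|x y Fx Fy].
- by rewrite (opD opT) // ripDl.
- by rewrite /rscale (opZ opT) // ripZl.
- by rewrite ripC -symT.
Qed.

Lemma sym_nrm_bound T d : 0 <= d -> bounded_operator_on F T -> sym_on T ->
  (forall x, F x -> `|rip (T x) x| <= d * nrm x ^+ 2) ->
  forall x, F x -> nrm (T x) <= d * nrm x.
Proof.
move=> d0 opT symT hd x Fx; have FT := op_in opT Fx.
have := sym_bound opT symT hd Fx FT; rewrite -nrm_sqr expr2.
have [u_gt0|u_le0 _] := ltP 0 (nrm (T x)); first by rewrite ler_pM2r.
by apply: le_trans u_le0 _; rewrite mulr_ge0 ?nrm_ge0.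
Qed.
(** * Square roots *)

Lemma converges_unique u l m : converges u l -> converges u m -> l = m.
Proof.
move=> ul um; apply/eqP; rewrite -subr_eq0; apply/eqP/nrm_eq0/eqP.
rewrite eq_le nrm_ge0 andbT; apply/ler_addgt0Pr => e e0; rewrite add0r.
have [|N hN] := ul (e / 2); first by rewrite divr_gt0.
have [|M hM] := um (e / 2); first by rewrite divr_gt0.
apply: le_trans (nrm_chain (u (N + M)%N) _ _) _; rewrite (nrmBC l) [leRHS]splitr.
by rewrite lerD ?hN ?hM ?leq_addr ?leq_addl.
Qed.

Lemma converges_lin a u v l m : converges u l -> converges v m ->
  converges (fun n => a *: u n + v n) (a *: l + m).
Proof.
move=> ul vm e e0; pose c := scalar_re `|a| + 1.
have c0 : 0 < c by rewrite ltr_wpDl ?re_norm_ge0.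
have [|N hN] := ul (e / 2 / c); first by rewrite !divr_gt0.
have [|M hM] := vm (e / 2); first by rewrite divr_gt0.
exists (N + M)%N => n NMn; rewrite opprD addrACA -scalerBr.
apply: le_trans (nrmD _ _) _; rewrite [leRHS]splitr lerD //; last first.
  by apply: hM; apply: leq_trans NMn; exact: leq_addl.
have := hN n (leq_trans (leq_addr M N) NMn); rewrite ler_pdivlMr // => h.
rewrite nrmZ_scalar; apply: le_trans h; rewrite mulrC ler_wpM2l ?nrm_ge0 //.
by rewrite /c lerDl.
Qed.

Lemma converges_nrm_le u l (C : R) : converges u l -> (forall n, nrm (u n) <= C) -> nrm l <= C.
Proof.
move=> ul uC; apply/ler_addgt0Pr => e e0; have [N hN] := ul _ e0.
have := nrm_chain (u N) l 0; rewrite !subr0 nrmBC => /le_trans; apply.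
by rewrite addrC lerD // hN.
Qed.

Lemma converges_rip u l x c : converges u l -> (forall n, rip (u n) x = c n) ->
  forall e : R, 0 < e -> exists N, forall n, (N <= n)%N -> `|c n - rip l x| <= e.
Proof.
move=> ul cE e e0; have p0 : 0 < nrm x + 1 by rewrite ltr_wpDl ?nrm_ge0.
have [|N hN] := ul (e / (nrm x + 1)); first by rewrite divr_gt0.
exists N => n /hN; rewrite ler_pdivlMr // -cE => h.
have -> : rip (u n) x - rip l x = rip (u n - l) x by rewrite !ripE.
rewrite ler_norml; have := rip_le (u n - l) x; have := rip_ge (u n - l) x.
by have := nrm_ge0 (u n - l); have := nrm_ge0 x => *; apply/andP; split; nra.
Qed.

Section SquareRoot.
Variables (B : H -> H) (b : R).
Hypotheses (opB' : bounded_operator_on F B) (symB : sym_on B).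
Hypotheses (b0 : 0 <= b) (b1 : b < 1) (Bb : forall x, F x -> nrm (B x) <= b * nrm x).

(** The smaller root of [b + r ^+ 2 = 2 r]: the ball of radius [r] is stable
    under the iteration. *)
Let r := 1 - Num.sqrt (1 - b).

Let r_fix : b + r ^+ 2 = 2 * r.
Proof.
have : Num.sqrt (1 - b) ^+ 2 = 1 - b by rewrite sqr_sqrtr // subr_ge0 ltW.
by rewrite /r; move=> h; rewrite sqrrB h; ring.
Qed.

Let r0 : 0 <= r.
Proof.
have : Num.sqrt (1 - b) <= Num.sqrt 1 by rewrite ler_sqrt ?ltr01 // gerBl.
by rewrite sqrtr1 subr_ge0.
Qed.

Let r1 : r < 1.
Proof. by rewrite gtrBl sqrtr_gt0 subr_gt0. Qed.

Let Y n : H -> H := iter n (fun (f : H -> H) x => rscale 2^-1 (B x + f (f x))) (fun=> 0).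

Let Y_op n : bounded_operator_on F (Y n).
Proof.
elim: n => [|n IH].
  split=> [x _|a x y _ _|]; [exact: sub0|by rewrite scaler0 addr0|].
  by exists 0 => x _; rewrite nrm0 mul0r.
apply: op_ext (op_lin (scalar_emb 2^-1) (scalar_emb 2^-1) opB' (op_comp IH IH)) _ => x.
by rewrite -scalerDr.
Qed.

Let Y_sym n : sym_on (Y n).
Proof.
elim: n => [|n IH] x y Fx Fy; first by rewrite rip0l rip0r.
have Yn := op_in (Y_op n); rewrite /= -/(Y n) !ripE symB //.
by rewrite (IH _ y) ?(IH x) //; exact: Yn.
Qed.

Let Y_le n x : F x -> nrm (Y n x) <= r * nrm x.
Proof.
elim: n x => [|n IH] x Fx; first by rewrite /= nrm0 mulr_ge0 ?nrm_ge0.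
rewrite /= -/(Y n) nrmZ ger0_norm ?invr_ge0 //.
have h1 := Bb Fx; have h2 := IH _ (op_in (Y_op n) Fx); have h3 := IH _ Fx.
have h4 := nrmD (B x) (Y n (Y n x)).
have : r * nrm (Y n x) <= r * (r * nrm x) by rewrite ler_wpM2l.
have : (b + r ^+ 2) * nrm x = 2 * r * nrm x by rewrite r_fix.
by rewrite expr2; lra.
Qed.

(** Without commutation: [Y' Y' - Y Y = Y' (Y' - Y) + (Y' - Y) Y], and both
    factors [Y'] and [Y] have norm at most [r]. *)
Let Y_step n x : F x -> nrm (Y n.+1 x - Y n x) <= nrm x * r ^+ n.
Proof.
elim: n x => [|n IH] x Fx.
  rewrite /= addr0 subr0 expr0 mulr1 nrmZ ger0_norm ?invr_ge0 //.
  have : b * nrm x <= nrm x by rewrite ler_piMl ?nrm_ge0 ?ltW.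
  by have := Bb Fx; have := nrm_ge0 x; lra.
have FY m z : F z -> F (Y m z) by exact: (op_in (Y_op m)).
have -> : Y n.+2 x - Y n.+1 x =
    rscale 2^-1 (Y n.+1 (Y n.+1 x - Y n x) + (Y n.+1 (Y n x) - Y n (Y n x))).
  rewrite (opB (Y_op n.+1)); try exact: FY.
  rewrite subrKA -[Y n.+2 x]/(rscale 2^-1 (B x + Y n.+1 (Y n.+1 x))).
  rewrite -[in X in _ - X = _]/(rscale 2^-1 (B x + Y n (Y n x))) -scalerBr.
  by rewrite opprD addrACA subrr add0r.
have FD : F (Y n.+1 x - Y n x) by apply: subB; exact: FY.
rewrite nrmZ ger0_norm ?invr_ge0 //.
have h1 := Y_le n.+1 FD; have h2 := IH _ (FY n x Fx).
have h3 := nrmD (Y n.+1 (Y n.+1 x - Y n x)) (Y n.+1 (Y n x) - Y n (Y n x)).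
have h4 : r * nrm (Y n.+1 x - Y n x) <= r * (nrm x * r ^+ n) by rewrite ler_wpM2l ?IH.
have h5 : nrm (Y n x) * r ^+ n <= r * nrm x * r ^+ n.
  by rewrite ler_wpM2r ?exprn_ge0 ?Y_le.
by rewrite exprS; lra.
Qed.

(** The fixed point [Y] of [Y = (B + Y ^+ 2) / 2] satisfies
    [(1 - Y) ^+ 2 = 1 - B], and [nrm (Y x) <= r * nrm x] makes the form of
    [1 - Y] at least [1 - r = sqrt (1 - b)]. The iteration converges pointwise
    on [F] because it contracts the ball of radius [r < 1]. *)
Lemma square_root : exists S, [/\ bounded_operator_on F S, sym_on S,
  forall x, F x -> S (S x) = x - B x &
  forall x, F x -> Num.sqrt (1 - b) * nrm x ^+ 2 <= rip (S x) x].
Proof.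
have lim x : F x -> exists l, converges (fun n => Y n x) l.
  by move=> Fx; apply: (geometric_converges (nrm_ge0 x) r0 r1) => n; exact: Y_step.
pose Z x := xget 0 [set l | converges (fun n => Y n x) l].
have ZP x : F x -> converges (fun n => Y n x) (Z x).
  by move=> /lim; exact: xgetPex.
have FZ x : F x -> F (Z x).
  move=> Fx; apply: (closed_converges (proj2 Fs) _ (ZP _ Fx)) => n.
  exact: (op_in (Y_op n)).
have Zr x : F x -> nrm (Z x) <= r * nrm x.
  by move=> Fx; apply: (converges_nrm_le (ZP _ Fx)) => n; exact: Y_le.
have Zop : bounded_operator_on F Z.
  split; [exact: FZ| |by exists r].
  move=> a x y Fx Fy; apply: (converges_unique (ZP _ (sub_linear a Fx Fy))).
  rewrite (_ : (fun n => _) = fun n => a *: Y n x + Y n y).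
    exact: (converges_lin a (ZP _ Fx) (ZP _ Fy)).
  by apply/funext => n; rewrite (op_linear (Y_op n)).
have Zsym : sym_on Z.
  move=> x y Fx Fy; apply/eqP; rewrite -subr_eq0 -normr_le0.
  apply/ler_addgt0Pr => e e0; rewrite add0r.
  have [|N hN] := converges_rip (ZP _ Fx) (fun n => erefl (rip (Y n x) y)) (e := e / 2).
    exact: divr_gt0.
  have Yc n : rip (Y n y) x = rip (Y n x) y by rewrite Y_sym // ripC.
  have [|M hM] := converges_rip (ZP _ Fy) Yc (e := e / 2); first by rewrite divr_gt0.
  rewrite (ripC x); have := hN _ (leq_addr M N); have := hM _ (leq_addl N M).
  rewrite !ler_norml => /andP[h1 h2] /andP[h3 h4].
  by apply/andP; split; lra.
have ZZ x : F x -> B x + Z (Z x) = Z x + Z x.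
  move=> Fx; have -> : Z x + Z x = rscale 2 (Z x).
    by rewrite /rscale embn scaler_nat mulr2n.
  have conv2 : converges (fun n => rscale 2 (Y n.+1 x)) (rscale 2 (Z x)).
    rewrite -[X in converges _ X]addr0.
    rewrite (_ : (fun n => _) = fun n => rscale 2 (Y n.+1 x) + 0); last first.
      by apply/funext => n; rewrite addr0.
    apply: (converges_lin (scalar_emb 2)) => [e e0|e e0].
      have [N hN] := ZP _ Fx _ e0; exists N => n Nn.
      by apply: hN; exact: leq_trans (leqnSn n).
    by exists 0%N => n _; rewrite subrr nrm0 ltW.
  apply: converges_unique conv2 => e e0.
  have [|N hN] := ZP _ Fx (e / 2); first by rewrite divr_gt0.
  have [|M hM] := ZP _ (FZ _ Fx) (e / 2); first by rewrite divr_gt0.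
  exists (N + M)%N => n NMn.
  have -> : rscale 2 (Y n.+1 x) = B x + Y n (Y n x).
    by rewrite /= -/(Y n) /rscale scalerA -embM divff // emb1 scale1r.
  rewrite opprD addrACA subrr add0r.
  have FYn : F (Y n x) by exact: (op_in (Y_op n)).
  apply: le_trans (nrm_chain (Y n (Z x)) _ _) _.
  rewrite -(opB (Y_op n)) //; last exact: FZ.
  have h1 := Y_le n (subB FYn (FZ _ Fx)).
  have h2 := hN n (leq_trans (leq_addr M N) NMn).
  have h3 := hM n (leq_trans (leq_addl N M) NMn).
  have : r * nrm (Y n x - Z x) <= nrm (Y n x - Z x) by rewrite ler_piMl ?nrm_ge0 ?ltW.
  by lra.
exists (fun x => x - Z x); split.
- by apply: op_ext (op_scalarB 1 Zop) _ => x; rewrite scale1r.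
- by move=> x y Fx Fy; rewrite !ripE Zsym.
- move=> x Fx; rewrite (opB Zop) //; last exact: FZ.
  have -> : Z (Z x) = Z x + Z x - B x by rewrite -ZZ // addrAC subrr add0r.
  by rewrite opprB [Z x + Z x - B x - Z x]addrAC addrK subrKA.
- move=> x Fx; rewrite !ripE -nrm_sqr; have := rip_le (Z x) x; have := Zr _ Fx.
  have : Num.sqrt (1 - b) = 1 - r by rewrite /r; ring.
  by move=> -> h1 h2; have := nrm_ge0 x; rewrite expr2; nra.
Qed.
End SquareRoot.
End Subspace.

(** * Gaps *)

Lemma closed_subspace_setT : closed_subspace [set: H].
Proof. by split; [split=> [|a x y _ _]; exact/mem_set|exact: closedT]. Qed.

Lemma nonzero_vector (F : set H) : closed_subspace F -> F <> [set 0] ->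
  exists2 x, F x & 0 < nrm x.
Proof.
move=> Fs F0; apply: contrapT => noex; apply: F0; apply/seteqP; split=> [x Fx|_ -> /=].
  by apply: contrapT => /nrm_gt0 x0; apply: noex; exists x.
exact: sub0.
Qed.

Lemma projZ (F : set H) r x : closed_subspace F ->
  proj ip F (rscale r x) = rscale r (proj ip F x).
Proof.
move=> Fs; rewrite /rscale -[_ *: x]addr0 proj_linear // (proj_id Fs (sub0 Fs)) addr0.
by [].
Qed.

Lemma gap_bound (F G : set H) x : closed_subspace F -> closed_subspace G ->
  nrm (proj ip F x - proj ip G x) <= gap ip F G * nrm x.
Proof.
move=> Fs Gs; have [x0|/eqP/nrm_gt0 x0] := eqVneq x 0.
  by rewrite x0 !proj_id ?subrr ?nrm0 ?mulr0 //; exact: sub0.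
pose y := rscale (nrm x)^-1 x.
have y1 : nrm y = 1.
  by rewrite nrmZ ger0_norm ?invr_ge0 ?nrm_ge0 // mulVf // gt_eqF.
have -> : proj ip F x - proj ip G x = rscale (nrm x) (proj ip F y - proj ip G y).
  rewrite /y !projZ // /rscale -scalerBr scalerA -embM divff ?gt_eqF // emb1.
  by rewrite scale1r.
rewrite nrmZ ger0_norm ?nrm_ge0 // mulrC ler_pM2r //.
apply: sup_upper_bound; last by exists y => //=; rewrite y1.
split; first by exists (nrm (proj ip F y - proj ip G y)), y => //=; rewrite y1.
exists 2 => _ [z /= z1 <-]; apply: le_trans (nrmD _ _) _.
by rewrite nrmN; have := nrm_proj Fs z; have := nrm_proj Gs z; lra.
Qed.

Lemma gap_ge0 (F G : set H) x : closed_subspace F -> closed_subspace G -> 0 < nrm x ->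
  0 <= gap ip F G.
Proof.
move=> Fs Gs x0; rewrite -(ler_pM2r x0) mul0r.
exact: le_trans (nrm_ge0 _) (gap_bound x Fs Gs).
Qed.

(** * Ritz values *)

Section RitzValues.
Variable A : {linear H -> H}.
Hypothesis A_bounded : bounded_on [set: H] A.
Hypothesis A_selfadjoint : selfadjoint ip A.

Lemma op_A : bounded_operator_on [set: H] A.
Proof. by split=> // a x y _ _; rewrite linearP. Qed.

Lemma A_sym x y : rip (A x) y = rip x (A y).
Proof. by rewrite /rip A_selfadjoint. Qed.

Lemma op_ritz (F : set H) : closed_subspace F ->
  bounded_operator_on F (fun x => proj ip F (A x)).
Proof.
move=> Fs; split=> [x _|a x y _ _|]; first exact: proj_in.
  by rewrite linearP proj_linear.
have [M M0 hM] := op_bound op_A; exists M => x _.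
exact: le_trans (nrm_proj Fs _) (hM x I).
Qed.

Lemma sym_ritz (F : set H) : closed_subspace F -> sym_on F (fun x => proj ip F (A x)).
Proof. by move=> Fs x y Fx Fy; rewrite proj_rip // proj_ripr // A_sym. Qed.

Lemma ritz_valuesP (F : set H) l : closed_subspace F ->
  ritz_values ip A F l <->
  exists2 r, l = scalar_emb r & real_spectrum F (fun x => proj ip F (A x)) r.
Proof. by move=> Fs; apply: spectrum_onP => //; [exact: op_ritz|exact: sym_ritz]. Qed.

Variables m M : R.
Hypothesis mA : forall x, m * nrm x ^+ 2 <= rip (A x) x.
Hypothesis AM : forall x, rip (A x) x <= M * nrm x ^+ 2.
Hypothesis mM : m <= M.

(** For [f] and [g] of equal norm, subtracting [(M + m) / 2] from [A] does not
    change the difference of the two forms, which is then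
    [rip (A' (f + g)) (f - g)] with [nrm A' <= (M - m) / 2]. The product of the
    norms of [f + g] and [f - g] is twice the sine of the angle between [f] and
    [g] times [nrm f ^+ 2], and [c] bounds that sine. *)
Lemma form_diff f g (c : R) : 0 <= c <= 1 -> nrm f = nrm g ->
  Num.sqrt (1 - c ^+ 2) * nrm f ^+ 2 <= rip f g ->
  rip (A f) f - rip (A g) g <= (M - m) * c * nrm f ^+ 2.
Proof.
move=> /andP[c0 c1] fg cos_fg; pose mid := (M + m) / 2; pose h := (M - m) / 2.
have h0 : 0 <= h by rewrite divr_ge0 ?subr_ge0.
have opA' := op_real_shift closed_subspace_setT mid op_A.
have symA' : sym_on [set: H] (fun x => rscale mid x - A x).
  by move=> x y _ _; rewrite !ripE A_sym.
have hA' x : [set: H] x -> `|rip (rscale mid x - A x) x| <= h * nrm x ^+ 2.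
  move=> _; rewrite !ripE -nrm_sqr ler_norml; have := mA x; have := AM x.
  by rewrite /mid /h => ? ?; apply/andP; split; lra.
have := sym_bound closed_subspace_setT opA' symA' hA' (x := f + g) (y := - (f - g)) I I.
rewrite nrmN linearD !ripE -!nrm_sqr -fg (A_sym g f) (ripC g (A f)) (ripC g f).
set p := nrm (f + g); set q := nrm (f - g); set N := nrm f ^+ 2.
move=> diff; have pq : p * q <= 2 * c * N.
  rewrite -(ler_pXn2r (n := 2)) ?nnegrE ?mulr_ge0 ?nrm_ge0 ?exprn_ge0 ?nrm_ge0 //.
  rewrite exprMn nrm_sqrD nrm_sqrB -fg -/N.
  have s2 : Num.sqrt (1 - c ^+ 2) ^+ 2 = 1 - c ^+ 2.
    by rewrite sqr_sqrtr // subr_ge0 expr_le1.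
  have : (Num.sqrt (1 - c ^+ 2) * N) ^+ 2 <= rip f g ^+ 2.
    rewrite ler_pXn2r ?nnegrE ?mulr_ge0 ?sqrtr_ge0 ?exprn_ge0 ?nrm_ge0 //.
    by apply: le_trans cos_fg; rewrite mulr_ge0 ?sqrtr_ge0 ?exprn_ge0 ?nrm_ge0.
  by rewrite exprMn s2; nra.
have : h * (p * q) <= h * (2 * c * N) by rewrite ler_wpM2l.
by rewrite mulrA => hpq; move: diff; rewrite /h /mid in hpq *; lra.
Qed.

Section Transfer.
Variables F G : set H.
Hypotheses (Fs : closed_subspace F) (Gs : closed_subspace G).
Variable c : R.
Hypotheses (c0 : 0 <= c) (c1 : c < 1).
Hypothesis FGc : forall x, nrm (proj ip F x - proj ip G x) <= c * nrm x.
Local Notation P := (proj ip F).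
Local Notation Q := (proj ip G).

(** The polar decomposition of [Q P]: [W = Q S^-1] with [S ^+ 2 = P Q] on [F],
    where [1 - P Q] has the form [nrm (P x - Q x) ^+ 2 <= c ^+ 2 * nrm x ^+ 2].
    Writing [x = S h], isometry reads [rip (P (Q h)) h = rip (S h) (S h)], and
    the bound on the angle reads [rip (S h) (Q h) = rip (S (S h)) (S h)], where
    the form of [S] is at least [sqrt (1 - c ^+ 2)]. *)
Lemma isometry_of_gap : exists W : H -> H,
  [/\ forall x, F x -> G (W x),
      forall a x y, F x -> F y -> W (a *: x + y) = a *: W x + W y,
      forall x y, F x -> F y -> rip (W x) (W y) = rip x y,
      forall y, G y -> exists2 x, F x & W x = y
    & forall x, F x -> Num.sqrt (1 - c ^+ 2) * nrm x ^+ 2 <= rip x (W x)].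
Proof.
have PF x : F (P x) by exact: proj_in.
have QG x : G (Q x) by exact: proj_in.
pose B x := x - P (Q x).
have opPQ : bounded_operator_on F (fun x => P (Q x)).
  split=> [//|a x y _ _|]; first by rewrite !proj_linear.
  exists 1 => x _; rewrite mul1r.
  exact: le_trans (nrm_proj Fs _) (nrm_proj Gs _).
have opB1 : bounded_operator_on F B.
  by apply: op_ext (op_scalarB Fs 1 opPQ) _ => x; rewrite scale1r.
have symPQ x y : F x -> F y -> rip (P (Q x)) y = rip (Q x) (Q y).
  by move=> Fx Fy; rewrite (proj_rip Fs) // (proj_ripr Gs).
have symB : sym_on F B.
  by move=> x y Fx Fy; rewrite !ripE symPQ // (ripC x (P _)) symPQ // (ripC (Q y)).
have Bc x : F x -> `|rip (B x) x| <= c ^+ 2 * nrm x ^+ 2.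
  move=> Fx; have -> : rip (B x) x = nrm (P x - Q x) ^+ 2.
    rewrite (proj_id Fs Fx) nrm_sqrB !ripE symPQ // -!nrm_sqr ripC.
    by rewrite -nrm_proj_sqr //; ring.
  by rewrite ger0_norm ?sqr_ge0 // -exprMn ler_pXn2r ?nnegrE ?mulr_ge0 ?nrm_ge0.
have c2 : 0 <= c ^+ 2 by exact: sqr_ge0.
have c21 : c ^+ 2 < 1 by rewrite expr_lt1.
have [S [opS symS SS Sge]] :=
  square_root Fs opB1 symB c2 c21 (sym_nrm_bound Fs c2 opB1 symB Bc).
have s0 : 0 < Num.sqrt (1 - c ^+ 2) by rewrite sqrtr_gt0 subr_gt0.
have FS x : F x -> F (S x) by exact: (op_in opS).
have bbS : bounded_below F S.
  exists (Num.sqrt (1 - c ^+ 2)) => // x Fx.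
  have [x_gt0|x_le0] := ltP 0 (nrm x).
    rewrite -(ler_pM2r x_gt0) -mulrA -expr2.
    exact: le_trans (Sge _ Fx) (rip_le (S x) x).
  by rewrite (le_trans _ (nrm_ge0 _)) // mulr_ge0_le0 // ltW.
have [Si [opSi SiP]] := bounded_below_inverse Fs opS opS symS bbS bbS.
have FSi x : F x -> F (Si x) by exact: (op_in opSi).
have SSE x : F x -> S (S x) = P (Q x) by move=> Fx; rewrite SS // /B opprB addrC subrK.
exists (fun x => Q (Si x)); split.
- by [].
- by move=> a x y Fx Fy; rewrite (op_linear opSi) // proj_linear.
- move=> x y Fx Fy; rewrite -symPQ ?FSi //; try exact: FSi.
  rewrite -SSE; last exact: FSi.
  rewrite (SiP x Fx).2 symS //; last exact: FSi.
  by rewrite (SiP y Fy).2.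
- move=> y Gy; have FPy := PF y; exists (Si (P y)); first exact: FSi.
  (* [Q h - y] lies in [G] and [P] kills it, so [c < 1] forces it to be 0. *)
  set h := Si (Si (P y)); have Fh : F h by exact/FSi/FSi.
  have PQh : P (Q h) = P y.
    by rewrite -SSE // (SiP _ (FSi _ FPy)).2 (SiP _ FPy).2.
  have := FGc (Q h - y); rewrite !(projB Fs, projB Gs) PQh subrr sub0r nrmN.
  rewrite -(projB Gs) (proj_id Gs (subB Gs (QG h) Gy)) => zc.
  apply/eqP; rewrite -subr_eq0; apply/eqP/nrm_eq0/eqP.
  rewrite eq_le nrm_ge0 andbT -(pmulr_rle0 (x := 1 - c)) ?subr_gt0 //.
  by rewrite mulrBl mul1r subr_le0.
move=> x Fx; have Fh := FSi _ Fx; rewrite -{2}(SiP x Fx).2.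
rewrite -(proj_ripr Fs) ?FS //; last exact: FS.
rewrite -SSE // (SiP x Fx).2 ripC; exact: Sge.
Qed.

(** The vector [W f] has the residual of [f] increased by at most
    [(M - m) * c]: test the residual of [W f] against itself, written as [W f'],
    and compare the forms of [A] at [(f, f')] and at [(W f, W f')]. *)
Lemma ritz_transfer r e : real_spectrum F (fun x => P (A x)) r -> 0 < e ->
  exists2 s, real_spectrum G (fun x => Q (A x)) s & `|r - s| <= (M - m) * c + e.
Proof.
move=> spec_r e0; have [W [GW WP Wiso Wonto Wcos]] := isometry_of_gap.
have [f [Ff f_gt0 fe]] := approximate_eigenvector spec_r e0.
have Wn x : F x -> nrm (W x) = nrm x.
  move=> Fx; apply/eqP; rewrite -(eqrXn2 (n := 2)) ?nrm_ge0 //.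
  by rewrite !nrm_sqr Wiso.
pose b x y := rip (A x) y - rip (A (W x)) (W y).
have WZ r' x : F x -> W (rscale r' x) = rscale r' (W x).
  move=> Fx; have W0 : W 0 = 0 by apply/nrm_eq0; rewrite Wn ?nrm0 //; exact: sub0.
  by rewrite -[rscale r' x]addr0 WP ?W0 ?addr0 //; exact: sub0.
have WD x y : F x -> F y -> W (x + y) = W x + W y.
  by move=> Fx Fy; rewrite -{1}[x]scale1r WP // scale1r.
have b_bound : forall x y, F x -> F y -> b x y <= (M - m) * c * nrm x * nrm y.
  apply: form_bound => // [x y z Fx Fy Fz|r' x y Fx Fy|x y Fx Fy|x Fx].
  - by rewrite /b WD // !linearD !ripDl; ring.
  - by rewrite /b WZ // /rscale !linearZ /= -!/(rscale _ _) !ripZl; ring.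
  - by rewrite /b (ripC (A x)) (ripC (A (W x))) -!A_sym.
  - have c01 : 0 <= c <= 1 by rewrite c0 ltW.
    have := form_diff c01 (esym (Wn x Fx)) (Wcos x Fx).
    have := form_diff c01 (Wn x Fx); rewrite Wn // ripC => /(_ (Wcos x Fx)) h1 h2.
    by rewrite ler_norml /b; apply/andP; split; lra.
have fW : 0 < nrm (W f) by rewrite Wn.
apply: (near_real_spectrum Gs (op_ritz Gs) (sym_ritz Gs) (GW f Ff) fW).
set z := rscale r (W f) - Q (A (W f)).
have Gz : G z by apply: (subB Gs); [exact/(subZ Gs)/GW|exact: proj_in].
have [f' Ff' f'z] := Wonto _ Gz.
have zE : z = rscale r (W f) - Q (A (W f)) by [].
clearbody z.
have : nrm z * nrm z <= ((M - m) * c + e) * nrm (W f) * nrm z.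
  rewrite -expr2 nrm_sqr {1}zE !ripE (proj_rip Gs) // -f'z Wiso // !Wn //.
  have := b_bound f f' Ff Ff'; rewrite /b.
  have := rip_le (rscale r f - P (A f)) f'; rewrite !ripE (proj_rip Fs) //.
  have : nrm (rscale r f - P (A f)) * nrm f' <= e * nrm f * nrm f'.
    by rewrite ler_wpM2r ?nrm_ge0 ?ltW.
  by lra.
have [z_gt0|z_le0 _] := ltP 0 (nrm z); first by rewrite ler_pM2r.
apply: le_trans z_le0 _; rewrite mulr_ge0 ?nrm_ge0 // addr_ge0 ?(ltW e0) //.
by rewrite mulr_ge0 // subr_ge0.
Qed.
End Transfer.

Lemma ritz_range (F : set H) r : closed_subspace F ->
  real_spectrum F (fun x => proj ip F (A x)) r -> m <= r <= M.
Proof.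
move=> Fs spec_r; apply/andP; split.
  apply: (real_spectrum_ge spec_r) => x Fx.
  by rewrite proj_rip.
apply: (real_spectrum_le spec_r) => x Fx.
by rewrite proj_rip.
Qed.

(** Beyond gap 1 the bound is at least [M - m], the length of the interval that
    contains all Ritz values. *)
Lemma ritz_near (F G : set H) r e : closed_subspace F -> closed_subspace G ->
  G <> [set 0] -> real_spectrum F (fun x => proj ip F (A x)) r -> 0 < e ->
  exists2 s, real_spectrum G (fun x => proj ip G (A x)) s
    & `|r - s| <= (M - m) * gap ip F G + e.
Proof.
move=> Fs Gs /(nonzero_vector Gs)[x0 Gx0 x0_gt0] spec_r e0.
have [c1|c1] := ltP (gap ip F G) 1.
  apply: (ritz_transfer Fs Gs _ c1) => //; first exact: gap_ge0 x0_gt0.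
  by move=> x; exact: gap_bound.
have [s spec_s _] := form_sup Gs (op_ritz Gs) (sym_ritz Gs) Gx0 x0_gt0.
exists s => //; have /andP[mr rM] := ritz_range Fs spec_r.
have /andP[ms sM] := ritz_range Gs spec_s.
have : (M - m) * 1 <= (M - m) * gap ip F G by rewrite ler_wpM2l ?subr_ge0.
by rewrite ler_norml => ?; apply/andP; split; lra.
Qed.

Lemma dist_ritz_le (F G : set H) (d : R) : closed_subspace F -> closed_subspace G ->
  F <> [set 0] ->
  (forall r e, real_spectrum F (fun x => proj ip F (A x)) r -> 0 < e ->
    exists2 s, real_spectrum G (fun x => proj ip G (A x)) s & `|r - s| <= d + e) ->
  sup [set dist_to u (ritz_values ip A G) | u in ritz_values ip A F] <= d.
Proof.
move=> Fs Gs /(nonzero_vector Fs)[x0 Fx0 x0_gt0] near_G.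
apply: ge_sup => [|_ [u /(ritz_valuesP _ Fs)[r -> spec_r] <-]].
  have [r spec_r _] := form_sup Fs (op_ritz Fs) (sym_ritz Fs) Fx0 x0_gt0.
  exists (dist_to (scalar_emb r : K) (ritz_values ip A G)), (scalar_emb r) => //.
  by apply/(ritz_valuesP _ Fs); exists r.
apply/ler_addgt0Pr => e e0; have [s spec_s rs] := near_G r e spec_r e0.
apply: le_trans rs; apply: ge_inf.
  by exists 0 => _ [v _ <-]; exact: re_norm_ge0.
exists (scalar_emb s); first by apply/(ritz_valuesP _ Gs); exists s.
by rewrite -embB re_norm_emb.
Qed.
End RitzValues.
End RealInnerProduct.

Theorem theorem5p2 (R : realType) (k : base_field)
    (H : completeNormedModType (scalars R k))
    (ip : {dot H for @scalar_conj R k}) (ip_norm : inner_product_norm ip)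
    (A : {linear H -> H}) (A_bounded : bounded_on [set: H] A)
    (A_selfadjoint : selfadjoint ip A)
    (F G : set H)
    (F_subspace : closed_subspace F) (F_nontrivial : F <> [set 0])
    (G_subspace : closed_subspace G) (G_nontrivial : G <> [set 0]) :
  exists lmin lmax : scalars R k,
    [/\ is_min (spectrum A) lmin,
        is_max (spectrum A) lmax
      & hausdorff_dist (ritz_values ip A F) (ritz_values ip A G)
          <= scalar_re (lmax - lmin) * gap ip F G].
Proof.
have [x0 _ x0_gt0] := nonzero_vector F_subspace F_nontrivial.
have opA := op_A A_bounded; have Ts := @closed_subspace_setT R k H.
have symA : sym_on ip [set: H] A by move=> x y _ _; exact: A_sym.
have [M specM AM] := form_sup ip_norm Ts opA symA (x0 := x0) I x0_gt0.
have [m specm mA] := form_inf ip_norm Ts opA symA (x0 := x0) I x0_gt0.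
have {}AM x := AM x I; have {}mA x := mA x I.
have specP l := spectrum_onP ip_norm Ts l opA symA.
have mM : m <= M by apply: (real_spectrum_ge ip_norm specM) => x _.
exists (scalar_emb m), (scalar_emb M); split.
- split; first by apply/specP; exists m.
  move=> _ /specP[r -> spec_r]; rewrite emb_le.
  by apply: (real_spectrum_ge ip_norm spec_r) => x _.
- split; first by apply/specP; exists M.
  move=> _ /specP[r -> spec_r]; rewrite emb_le.
  by apply: (real_spectrum_le ip_norm spec_r) => x _.
rewrite -embB re_emb ge_max; apply/andP; split.
  apply: dist_ritz_le => // r e spec_r e0; exact: ritz_near.
apply: dist_ritz_le => // r e spec_r e0.
have [s spec_s rs] := ritz_near ip_norm A_bounded A_selfadjoint mA AM mM
  G_subspace F_subspace F_nontrivial spec_r e0.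
exists s => //; suff <- : gap ip G F = gap ip F G by [].
rewrite /gap /opnorm; congr sup; apply/seteqP.
by split=> _ [x x1 <-]; exists x => //; rewrite nrmBC.
Qed.
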